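(* Let $\mathbf{U}^+$ be a pre-universe, let $\mathcal{A}$ be a $\mathbf{U}^+$-small category, let $\mathcal{C}, \mathcal{D}, \mathcal{C}^+, \mathcal{D}^+$ be locally $\mathbf{U}^+$-small categories, let $F : \mathcal{A} \to \mathcal{C}$ and $G : \mathcal{A} \to \mathcal{D}$ be functors, and let $i : \mathcal{C} \to \mathcal{C}^+$ and $j : \mathcal{D} \to \mathcal{D}^+$ be fully faithful functors. Let $H : \mathcal{C} \to \mathcal{D}$ and $H^+ : \mathcal{C}^+ \to \mathcal{D}^+$ be functors. (i) If $H^+$ is a pointwise right Kan extension of $jG$ along $iF$, and $H^+ i \cong jH$, then $H$ is a pointwise right Kan extension of $G$ along $F$. (ii) Suppose $\mathcal{C}$ is $\mathbf{U}^+$-small and $jH$ is a pointwise right Kan extension of $jG$ along $F$. If $H^+$ is a pointwise right Kan extension of $jH$ along $i$, then the counit $H^+ i \Rightarrow jH$ is a natural isomorphism, and $H^+$ is also a pointwise right Kan extension of $jG$ along $iF$; conversely, if $H^+$ is a pointwise right Kan extension of $jG$ along $iF$, then it is also a pointwise right Kan extension of $jH$ along $i$. (iii) If $\mathbf{U}$ is a pre-universe such that $\mathcal{A}$ is $\mathbf{U}$-small and $j$ preserves limits for all $\mathbf{U}$-small diagrams, and $H$ is a pointwise right Kan extension of $G$ along $F$, then a pointwise right Kan extension of $jG$ along $iF$ can be computed as a pointwise right Kan extension of $jH$ along $i$ (if either one exists). Dually: (i$'$) If $H^+$ is a pointwise left Kan extension of $jG$ along $iF$, and $H^+ i \cong jH$,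 then $H$ is a pointwise left Kan extension of $G$ along $F$. (ii$'$) Suppose $\mathcal{C}$ is $\mathbf{U}^+$-small and $jH$ is a pointwise left Kan extension of $jG$ along $F$. If $jH$ is a pointwise left Kan extension of $jG$ along $F$, and $H^+$ is a pointwise left Kan extension of $jH$ along $i$, then the unit $jH \Rightarrow H^+ i$ is a natural isomorphism, and $H^+$ is also a pointwise left Kan extension of $jG$ along $iF$. (iii$'$) If $\mathbf{U}$ is a pre-universe such that $\mathcal{A}$ is $\mathbf{U}$-small and $j$ preserves colimits for all $\mathbf{U}$-small diagrams, and $H$ is a pointwise left Kan extension of $G$ along $F$, then a pointwise left Kan extension of $jG$ along $iF$ can be computed as a pointwise left Kan extension of $jH$ along $i$ (if either one exists).
   Context: A pre-universe is a set $\mathbf{U}$ such that: if $x \in y$ and $y \in \mathbf{U}$ then $x \in \mathbf{U}$; if $x, y \in \mathbf{U}$ then $\{x,y\} \in \mathbf{U}$; if $x \in \mathbf{U}$ then the power set of $x$ is in $\mathbf{U}$; if $x \in \mathbf{U}$ and $f : x \to \mathbf{U}$ is a map then $\bigcup_{t \in x} f(t) \in \mathbf{U}$. All categories are sets (models of the theory of categories inside set theory). A category is $\mathbf{U}$-small if its sets of objects and morphisms are members of $\mathbf{U}$; it is locally $\mathbf{U}$-small if its sets of objects and morphisms are subsets of $\mathbf{U}$ and all its hom-sets are members of $\mathbf{U}$. A $\mathbf{U}$-small diagram is a functor from a $\mathbf{U}$-small category. For functors $F : \mathcal{A} \to \mathcal{C}$ and $G : \mathcal{A} \to \mathcal{D}$,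 a pointwise right Kan extension of $G$ along $F$ is a functor $H : \mathcal{C} \to \mathcal{D}$ (together with a natural transformation $HF \Rightarrow G$, the counit) exhibiting each $H(C)$ as the limit of $G$ weighted by $\mathrm{Hom}_{\mathcal{C}}(C, F-)$, i.e. the induced maps $\mathrm{Hom}_{\mathcal{D}}(D, HC) \to \mathrm{Nat}(\mathrm{Hom}_{\mathcal{C}}(C,F-), \mathrm{Hom}_{\mathcal{D}}(D,G-))$ are bijections for all $C$ and $D$. Dually, a pointwise left Kan extension of $G$ along $F$ is a functor $H : \mathcal{C} \to \mathcal{D}$ (together with a natural transformation $G \Rightarrow HF$, the unit) such that the induced maps $\mathrm{Hom}_{\mathcal{D}}(HC, D) \to \mathrm{Nat}(\mathrm{Hom}_{\mathcal{C}}(F-,C), \mathrm{Hom}_{\mathcal{D}}(G-,D))$ are bijections for all $C$ and $D$. None of the triangles formed by $F, G, H, i, j, H^+$ is assumed to commute.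
   Formalization: In (iii) it is additionally assumed that every hom-set Hom_C(X, FA) is a member of U, and in (iii') that every Hom_C(FA, X) is (as holds when C is locally U-small); without this, (iii) and (iii') fail, e.g. for U the hereditarily finite sets. *)

(* Defs.v *)
From HB Require Import structures.
From mathcomp Require Import all_boot.
From mathcomp Require Import boolp.

Set Implicit Arguments.
Unset Strict Implicit.
Unset Printing Implicit Defensive.

Local Open Scope quotient_scope.

(* Sets are well-founded trees (Aczel) modulo extensional equality.  Subsets
   and images of a [zset] under arbitrary Rocq predicates and functions are
   again [zset]s, so Rocq functions [elt x -> elt y] are the same thing as
   set-theoretic maps from x to y. *)

Inductive tree : Type := Node (I : Type) (t : I -> tree).

Fixpoint tree_eq (s t : tree) : Prop :=
  let: Node _ f := s in
  let: Node _ g := t in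
  (forall i, exists j, tree_eq (f i) (g j)) /\
  (forall j, exists i, tree_eq (f i) (g j)).

Lemma tree_eq_refl s : tree_eq s s.
Proof. by elim: s => I f IH; split=> i; exists i. Qed.

Lemma tree_eq_sym s t : tree_eq s t -> tree_eq t s.
Proof.
elim: s t => I f IH [J g] /= [fg gf]; split=> i.
- by have [j /IH] := gf i; exists j.
- by have [j /IH] := fg i; exists j.
Qed.

Lemma tree_eq_trans s t u : tree_eq s t -> tree_eq t u -> tree_eq s u.
Proof.
elim: s t u => I f IH [J g] [K h] /= [fg gf] [gh hg]; split=> i.
- by have [j fgj] := fg i; have [k] := gh j; exists k; apply: IH fgj _.
- by have [j ghj] := hg i; have [k fgk] := gf j; exists k; apply: IH fgk _.
Qed.

Definition tree_eqb : rel {classic tree} := fun s t => `[< tree_eq s t >].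

Lemma tree_eqb_refl : reflexive tree_eqb.
Proof. by move=> s; apply/asboolP/tree_eq_refl. Qed.

Lemma tree_eqb_sym : symmetric tree_eqb.
Proof. by move=> s t; apply/asboolP/asboolP; apply: tree_eq_sym. Qed.

Lemma tree_eqb_trans : transitive tree_eqb.
Proof.
by move=> t s u /asboolP st /asboolP tu; apply/asboolP; apply: tree_eq_trans tu.
Qed.

Canonical tree_equiv :=
  EquivRel tree_eqb tree_eqb_refl tree_eqb_sym tree_eqb_trans.

Definition zset : Type := {eq_quot tree_equiv}.

Definition zset_of_tree (t : tree) : zset := \pi_({eq_quot tree_equiv}) t.

Definition tree_of_zset (x : zset) : tree := repr (x : {eq_quot tree_equiv}).

Definition zmem (x y : zset) : Prop :=
  let: Node _ t := tree_of_zset y in exists i, x = zset_of_tree (t i).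

Notation "x ∈ y" := (zmem x y) (at level 70, no associativity).

Lemma tree_of_zsetK x : zset_of_tree (tree_of_zset x) = x.
Proof. exact: (@reprK _ {eq_quot tree_equiv}). Qed.

Lemma zset_of_treeP s t : zset_of_tree s = zset_of_tree t <-> tree_eq s t.
Proof.
split=> [/(@eqquotP _ tree_equiv {eq_quot tree_equiv} s t) /asboolP //|st].
by apply/(@eqquotP _ tree_equiv {eq_quot tree_equiv} s t); apply/asboolP.
Qed.

Lemma zmem_node x I (t : I -> tree) :
  x ∈ zset_of_tree (Node t) <-> exists i, x = zset_of_tree (t i).
Proof.
have /zset_of_treeP := tree_of_zsetK (zset_of_tree (Node t)).
rewrite /zmem; case: (tree_of_zset _) => J s /= [st ts].
split=> -[i ->].
- by have [j /zset_of_treeP ->] := st i; exists j.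
- by have [j /zset_of_treeP <-] := ts i; exists j.
Qed.

Lemma zset_ext x y : (forall z, z ∈ x <-> z ∈ y) -> x = y.
Proof.
rewrite -(tree_of_zsetK x) -(tree_of_zsetK y).
case: (tree_of_zset x) (tree_of_zset y) => I s [J t] xy.
apply/zset_of_treeP; split=> i.
- have /xy /zmem_node [j /zset_of_treeP] : zset_of_tree (s i) ∈ zset_of_tree (Node s).
    by apply/zmem_node; exists i.
  by exists j.
- have /xy /zmem_node [j /zset_of_treeP/tree_eq_sym] :
      zset_of_tree (t i) ∈ zset_of_tree (Node t).
    by apply/zmem_node; exists i.
  by exists j.
Qed.

Definition zsup (I : Type) (f : I -> zset) : zset :=
  zset_of_tree (Node (fun i => tree_of_zset (f i))).

Lemma zmem_sup x I (f : I -> zset) : x ∈ zsup f <-> exists i, x = f i.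
Proof.
split=> [/zmem_node|] [i]; first by rewrite tree_of_zsetK; exists i.
by move=> ->; apply/zmem_node; exists i; rewrite tree_of_zsetK.
Qed.

Definition elt (x : zset) : Type := {y : zset | y ∈ x}.

Definition zsubset (x y : zset) : Prop := forall z, z ∈ x -> z ∈ y.

Definition is_upair (x y p : zset) : Prop :=
  forall z, z ∈ p <-> z = x \/ z = y.

Definition is_powerset (x p : zset) : Prop :=
  forall z, z ∈ p <-> zsubset z x.

Definition is_bigcup (x : zset) (f : elt x -> zset) (u : zset) : Prop :=
  forall z, z ∈ u <-> exists t : elt x, z ∈ f t.

Record pre_universe (U : zset) : Prop := PreUniverse {
  pre_universe_trans : forall x y, x ∈ y -> y ∈ U -> x ∈ U;
  pre_universe_upair : forall x y, x ∈ U -> y ∈ U ->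
    exists p, is_upair x y p /\ p ∈ U;
  pre_universe_powerset : forall x, x ∈ U ->
    exists p, is_powerset x p /\ p ∈ U;
  pre_universe_bigcup : forall x (f : elt x -> zset), x ∈ U ->
    (forall t, f t ∈ U) -> exists u, is_bigcup f u /\ u ∈ U }.

Record quiver : Type := Quiver {
  ob : zset;
  mor : zset;
  src : elt mor -> elt ob;
  tgt : elt mor -> elt ob }.

Definition hom (Q : quiver) (X Y : elt (ob Q)) : Type :=
  {f : elt (mor Q) | src f = X /\ tgt f = Y}.

Record category : Type := Category {
  quiver_of :> quiver;
  idm : forall X : elt (ob quiver_of), hom X X;
  comp : forall X Y Z : elt (ob quiver_of), hom Y Z -> hom X Y -> hom X Z;
  comp1m : forall X Y (f : hom X Y), comp (idm Y) f = f;
  compm1 : forall X Y (f : hom X Y), comp f (idm X) = f;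
  compA : forall W X Y Z (h : hom Y Z) (g : hom X Y) (f : hom W X),
    comp h (comp g f) = comp (comp h g) f }.

Notation "g ⊚ f" := (comp g f) (at level 40, left associativity).

(* The set of morphisms from X to Y is a member of U. *)
Definition hom_mem (U : zset) (C : category) (X Y : elt (ob C)) : Prop :=
  exists h, (forall m, m ∈ h <-> exists f : hom X Y, m = sval (sval f)) /\
            h ∈ U.

Definition small (U : zset) (C : category) : Prop := ob C ∈ U /\ mor C ∈ U.

Definition locally_small (U : zset) (C : category) : Prop :=
  [/\ zsubset (ob C) U, zsubset (mor C) U &
      forall X Y : elt (ob C), hom_mem U X Y].

Record functor (C D : category) : Type := Functor {
  fobj :> elt (ob C) -> elt (ob D);
  fmap : forall X Y, hom X Y -> hom (fobj X) (fobj Y);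
  fmap1 : forall X, fmap (idm X) = idm (fobj X);
  fmapM : forall X Y Z (g : hom Y Z) (f : hom X Y),
    fmap (g ⊚ f) = fmap g ⊚ fmap f }.

Section FunctorComposition.
Variables (C D E : category) (G : functor D E) (F : functor C D).

Lemma fcomp_map1 X : fmap G (fmap F (idm X)) = idm (G (F X)).
Proof. by rewrite !fmap1. Qed.

Lemma fcomp_mapM X Y Z (g : hom Y Z) (f : hom X Y) :
  fmap G (fmap F (g ⊚ f)) = fmap G (fmap F g) ⊚ fmap G (fmap F f).
Proof. by rewrite !fmapM. Qed.

Definition fcomp : functor C E := Functor fcomp_map1 fcomp_mapM.
End FunctorComposition.

Notation "G ∘ F" := (fcomp G F) (at level 40, left associativity).

Definition fully_faithful (C D : category) (F : functor C D) : Prop :=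
  forall X Y, bijective (@fmap C D F X Y).

Record nattrans (C D : category) (F G : functor C D) : Type := NatTrans {
  ncomp :> forall X, hom (F X) (G X);
  ncompE : forall X Y (f : hom X Y), ncomp Y ⊚ fmap F f = fmap G f ⊚ ncomp X }.

Definition is_iso (C : category) (X Y : elt (ob C)) (f : hom X Y) : Prop :=
  exists g : hom Y X, g ⊚ f = idm X /\ f ⊚ g = idm Y.

Definition is_natiso (C D : category) (F G : functor C D)
    (a : nattrans F G) : Prop :=
  forall X, is_iso (a X).

Definition functor_iso (C D : category) (F G : functor C D) : Prop :=
  exists a : nattrans F G, is_natiso a.

Section Limits.
Variables (J D : category) (T : functor J D).

Definition is_cone (L : elt (ob D)) (p : forall x, hom L (T x)) : Prop :=
  forall x y (f : hom x y), fmap T f ⊚ p x = p y.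

Definition is_limit (L : elt (ob D)) (p : forall x, hom L (T x)) : Prop :=
  is_cone p /\
  forall M (q : forall x, hom M (T x)), is_cone q ->
    exists! h : hom M L, forall x, p x ⊚ h = q x.

Definition is_cocone (L : elt (ob D)) (p : forall x, hom (T x) L) : Prop :=
  forall x y (f : hom x y), p y ⊚ fmap T f = p x.

Definition is_colimit (L : elt (ob D)) (p : forall x, hom (T x) L) : Prop :=
  is_cocone p /\
  forall M (q : forall x, hom (T x) M), is_cocone q ->
    exists! h : hom L M, forall x, h ⊚ p x = q x.
End Limits.

Definition preserves_limits (U : zset) (D E : category) (j : functor D E) :
    Prop :=
  forall (J : category) (T : functor J D) (L : elt (ob D))
      (p : forall x, hom L (T x)),
    small U J -> is_limit p ->
    @is_limit J E (j ∘ T) (j L) (fun x => fmap j (p x)).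

Definition preserves_colimits (U : zset) (D E : category) (j : functor D E) :
    Prop :=
  forall (J : category) (T : functor J D) (L : elt (ob D))
      (p : forall x, hom (T x) L),
    small U J -> is_colimit p ->
    @is_colimit J E (j ∘ T) (j L) (fun x => fmap j (p x)).

Section KanExtensions.
Variables (A C D : category) (F : functor A C) (G : functor A D).

(* Nat(Hom_C(X, F-), Hom_D(Y, G-)) *)
Definition nat_from (X : elt (ob C)) (Y : elt (ob D)) : Type :=
  {n : forall a, hom X (F a) -> hom Y (G a) |
    forall a b (f : hom a b) (u : hom X (F a)),
      n b (fmap F f ⊚ u) = fmap G f ⊚ n a u}.

(* Nat(Hom_C(F-, X), Hom_D(G-, Y)) *)
Definition nat_to (X : elt (ob C)) (Y : elt (ob D)) : Type :=
  {n : forall a, hom (F a) X -> hom (G a) Y |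
    forall a b (f : hom a b) (u : hom (F b) X),
      n a (u ⊚ fmap F f) = n b u ⊚ fmap G f}.

Variable H : functor C D.

Section Right.
Variable eps : nattrans (H ∘ F) G.

Lemma ran_map_natural X Y (h : hom Y (H X)) a b (f : hom a b)
    (u : hom X (F a)) :
  eps b ⊚ fmap H (fmap F f ⊚ u) ⊚ h = fmap G f ⊚ (eps a ⊚ fmap H u ⊚ h).
Proof. by rewrite fmapM !compA -(ncompE eps). Qed.

Definition ran_map X Y (h : hom Y (H X)) : nat_from X Y :=
  exist _ (fun a u => eps a ⊚ fmap H u ⊚ h) (ran_map_natural h).

Definition is_ran_along : Prop := forall X Y, bijective (@ran_map X Y).
End Right.

Section Left.
Variable eta : nattrans G (H ∘ F).

Lemma lan_map_natural X Y (h : hom (H X) Y) a b (f : hom a b)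
    (u : hom (F b) X) :
  h ⊚ fmap H (u ⊚ fmap F f) ⊚ eta a = h ⊚ fmap H u ⊚ eta b ⊚ fmap G f.
Proof. by rewrite fmapM -!compA (ncompE eta). Qed.

Definition lan_map X Y (h : hom (H X) Y) : nat_to X Y :=
  exist _ (fun a u => h ⊚ fmap H u ⊚ eta a) (lan_map_natural h).

Definition is_lan_along : Prop := forall X Y, bijective (@lan_map X Y).
End Left.

Definition is_pointwise_ran : Prop := exists eps, is_ran_along eps.

Definition is_pointwise_lan : Prop := exists eta, is_lan_along eta.
End KanExtensions.

Arguments is_ran_along {A C D} F G H eps.
Arguments is_lan_along {A C D} F G H eta.

(* Main.v *)
(* Write Ran_F T for the pointwise right Kan extension.  If L = Ran_F T, then a
   natural family Hom(X, i -) -> Hom(Y, L -) is, by the Yoneda lemma, the same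
   as a natural family Hom(X, iF -) -> Hom(Y, T -); hence Ran_i L and Ran_{iF} T
   have the same universal property.  This gives (ii), whose claim on the counit
   is Yoneda again, since i is fully faithful.  For (iii), H = Ran_F G means
   that each H X is the limit of G over the category of elements of
   Hom(X, F -); this category has a U-small copy, so its limit is preserved by j
   and jH = Ran_F (jG), which reduces (iii) to the same comparison.  For (i),
   restrict Ran_{iF} (jG) along i and cancel j, both functors being fully
   faithful.  Left Kan extensions are dual. *)

From mathcomp Require Import all_boot.
From mathcomp Require Import boolp.
(* Imported last: [compA] must denote the category axiom, not ssrfun's lemma. *)
Require Import Defs.

Set Implicit Arguments.
Unset Strict Implicit.
Unset Printing Implicit Defensive.

(** * Choice, and inverses of fully faithful functors and of natural isomorphisms *)

Lemma bijective_exists_unique (S T : Type) (f : S -> T) :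
  bijective f <-> forall y, exists! x, f x = y.
Proof.
split=> [[g fK gK] y | f_ex].
  by exists (g y); split=> [|x <-]; rewrite ?gK ?fK.
have [g gP] := choice f_ex; exists g => [x | y]; last by have [] := gP y.
by have [_] := gP (f x); apply.
Qed.

Lemma dep_choice (T : Type) (U : T -> Type) (P : forall x, U x -> Prop) :
  (forall x, exists y, P x y) -> exists f : forall x, U x, forall x, P x (f x).
Proof.
by move=> Pex; exists (fun x => projT1 (cid (Pex x))) => x; case: cid.
Qed.

Lemma fully_faithful_inv (C D : category) (F : functor C D) :
  fully_faithful F -> exists F' : forall X Y, hom (F X) (F Y) -> hom X Y,
    forall X Y, cancel (@fmap _ _ F X Y) (F' X Y) /\
                cancel (F' X Y) (@fmap _ _ F X Y).
Proof.
move=> Fff.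
have Finv X : exists F' : forall Y, hom (F X) (F Y) -> hom X Y, forall Y,
    cancel (@fmap _ _ F X Y) (F' Y) /\ cancel (F' Y) (@fmap _ _ F X Y).
  apply: (dep_choice (P := fun Y F' => cancel _ F' /\ cancel F' _)) => Y.
  by have [g] := Fff X Y; exists g.
by have [F' F'P] := dep_choice Finv; exists F'.
Qed.

(** Pointwise inverses are automatically natural: insert [a X ⊚ b X] after [fmap G f], slide [f]
    across [a] and cancel at [Y]. *)
Lemma is_natiso_inv (C D : category) (F G : functor C D) (a : nattrans F G) :
  is_natiso a -> exists b : nattrans G F,
    forall X, b X ⊚ a X = idm (F X) /\ a X ⊚ b X = idm (G X).
Proof.
move=> /dep_choice [b ab].
suff bE X Y (f : hom X Y) : b Y ⊚ fmap G f = fmap F f ⊚ b X.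
  by exists (NatTrans bE).
rewrite -[fmap G f]compm1 -(ab X).2 [fmap G f ⊚ _]compA -ncompE.
by rewrite !compA (ab Y).1 comp1m.
Qed.

Lemma sval_inj (T : Type) (P : T -> Prop) : injective (@sval T P).
Proof. by move=> [x px] [y py] /= xy; apply: eq_exist. Qed.

Lemma existT_inj (T : Type) (P : T -> Type) (x : T) : injective (existT P x).
Proof.
move=> p q pq; have := projT2_eq pq.
by rewrite (Prop_irrelevance (projT1_eq pq) erefl).
Qed.

(** * Small types *)

(** With an injection as the definition, subtypes inherit smallness by composition;
    [small_bijective] later shrinks the set to the image. *)
Definition small_type (U : zset) (T : Type) : Prop :=
  exists2 x, x ∈ U & exists f : T -> elt x, injective f.

(* Kuratowski's pair: [s] is {x} and [d] is {x, y}. *)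
Definition is_opair (x y p : zset) : Prop :=
  exists s d, [/\ is_upair x x s, is_upair x y d & is_upair s d p].

Lemma is_opair_inj x y x' y' p :
  is_opair x y p -> is_opair x' y' p -> x = x' /\ y = y'.
Proof.
move=> [s [d [sP dP pP]]] [s' [d' [sP' dP' pP']]].
have xx : x' = x.
  have /pP' [ss'|sd'] : s ∈ p by apply/pP; left.
    have : x' ∈ s by rewrite ss'; apply/sP'; left.
    by move=> /sP [].
  have : x' ∈ s by rewrite sd'; apply/dP'; left.
  by move=> /sP [].
subst x'; split=> //.
have ss' : s' = s by apply: zset_ext => z; rewrite sP sP'.
subst s'.
(* Both lie in [p], so either they agree or both equal [s]. *)
have dd : d = d'.
  have [ds|//] : d = s \/ d = d' by apply/pP'/pP; right.
  have [d's|//] : d' = s \/ d' = d by apply/pP/pP'; right.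
  by rewrite ds d's.
have [yx|//] : y = x \/ y = y' by apply/dP'; rewrite -dd; apply/dP; right.
by have [->|] : y' = x \/ y' = y by apply/dP; rewrite dd; apply/dP'; right.
Qed.

Section Smallness.
Variable U : zset.
Hypothesis univU : pre_universe U.

(** A tree representing [x] is restricted to the branches whose value satisfies [P]. *)
Lemma zset_sep (x : zset) (P : zset -> Prop) :
  exists y, forall z, z ∈ y <-> z ∈ x /\ P z.
Proof.
rewrite -(tree_of_zsetK x); case: (tree_of_zset x) => I t.
exists (zsup (fun s : {k | P (zset_of_tree (t k))} =>
  zset_of_tree (t (sval s)))) => z; split.
  move=> /zmem_sup [[k Pk] ->]; split=> //=.
  by apply/zmem_node; exists k.
move=> [/zmem_node [k ->] Pk]; apply/zmem_sup.
by exists (exist _ k Pk).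
Qed.

Lemma subset_mem x y : x ∈ U -> zsubset y x -> y ∈ U.
Proof.
move=> /(pre_universe_powerset univU) [p [pP pU]] yx.
by apply: (pre_universe_trans univU) pU; apply/pP.
Qed.

Lemma singleton_mem x : x ∈ U -> exists2 s, s ∈ U & forall z, z ∈ s <-> z = x.
Proof.
move=> xU; have [s [sP sU]] := pre_universe_upair univU xU xU.
by exists s => // z; rewrite sP; split=> [[]|]; auto.
Qed.

Lemma opair_mem x y : x ∈ U -> y ∈ U -> exists2 p, p ∈ U & is_opair x y p.
Proof.
move=> xU yU.
have [s [sP sU]] := pre_universe_upair univU xU xU.
have [d [dP dU]] := pre_universe_upair univU xU yU.
have [p [pP pU]] := pre_universe_upair univU sU dU.
by exists p => //; exists s, d.
Qed.

Lemma elt_mem x (t : elt x) : x ∈ U -> sval t ∈ U.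
Proof. exact: pre_universe_trans (proj2_sig t). Qed.

Lemma small_elt x : x ∈ U -> small_type U (elt x).
Proof. by exists x => //; exists id. Qed.

Lemma small_inj (S T : Type) (f : S -> T) :
  injective f -> small_type U T -> small_type U S.
Proof.
move=> f_inj [x xU [g g_inj]].
by exists x => //; exists (g \o f); apply: inj_comp.
Qed.

(** The union axiom wants a family indexed by a member of [U]. The image [y] of [T] in [x] serves:
    it is a subset of [x], and [t] decodes its points. *)
Lemma small_bigcup (T : Type) (h : T -> zset) :
  small_type U T -> (forall t, h t ∈ U) ->
  exists2 u, u ∈ U & forall z, z ∈ u <-> exists t, z ∈ h t.
Proof.
move=> [x xU [f f_inj]] hU.
have [y yP] := zset_sep x (fun z => exists t, z = sval (f t)).
have yU : y ∈ U by apply: subset_mem xU _ => z /yP [].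
have [t tP] : exists t : elt y -> T, forall s, sval s = sval (f (t s)).
  apply: (dep_choice (P := fun s t => sval s = sval (f t))) => -[z zy].
  by have [_ [t zt]] := (yP z).1 zy; exists t.
have [u [uP uU]] :=
  pre_universe_bigcup univU yU (fun s : elt y => hU (t s)).
exists u => // z; rewrite uP; split=> [[s zs]|[k zk]]; first by exists (t s).
have ky : sval (f k) ∈ y by apply/yP; split; [case: (f k) | exists k].
pose s : elt y := exist (zmem^~ y) _ ky; exists s.
by have /sval_inj/f_inj <- : sval (f k) = sval (f (t s)) := tP s.
Qed.

(** Replacement, obtained as a union of singletons. *)
Lemma small_image (T : Type) (h : T -> zset) :
  small_type U T -> (forall t, h t ∈ U) ->
  exists2 u, u ∈ U & forall z, z ∈ u <-> exists t, z = h t.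
Proof.
move=> sT hU; have /dep_choice [s sP] t : exists s, s ∈ U /\
    forall z, z ∈ s <-> z = h t.
  by have [s] := singleton_mem (hU t); exists s.
have [u uU uP] := small_bigcup sT (fun t => (sP t).1).
by exists u => // z; rewrite uP; split=> -[t zt]; exists t; apply/(sP t).2.
Qed.

Lemma small_bijective (T : Type) :
  small_type U T -> exists2 x, x ∈ U & exists f : T -> elt x, bijective f.
Proof.
move=> sT; have [x xU [f f_inj]] := sT.
have [y yU yP] := small_image sT (fun t => elt_mem (f t) xU).
have fy t : sval (f t) ∈ y by apply/yP; exists t.
exists y => //; exists (fun t => exist (zmem^~ y) _ (fy t)).
apply/bijective_exists_unique => -[z zy].
have [t zt] := (yP z).1 zy; exists t; split; first exact: eq_exist.
by move=> k [kz]; apply: f_inj; apply: sval_inj; rewrite kz zt.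
Qed.

(** A pair is coded by the Kuratowski pair of the codes of its components; [u] unites the sets [v t]
    of codes lying above each [t]. *)
Lemma small_sigma (T : Type) (P : T -> Type) :
  small_type U T -> (forall t, small_type U (P t)) -> small_type U {t & P t}.
Proof.
move=> sT sP; have [x xU [f f_inj]] := sT.
have /dep_choice [y yP] t : exists y, y ∈ U /\
    exists g : P t -> elt y, injective g.
  by have [y] := sP t; exists y.
have /dep_choice [g g_inj] := fun t => (yP t).2.
have /dep_choice [c cP] (s : {t & P t}) : exists c, c ∈ U /\
    is_opair (sval (f (projT1 s))) (sval (g _ (projT2 s))) c.
  have [c cU cP] := opair_mem (elt_mem (f (projT1 s)) xU)
    (elt_mem (g _ (projT2 s)) (yP _).1); by exists c.
have /dep_choice [v vP] t : exists v, v ∈ U /\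
    forall z, z ∈ v <-> exists p, z = c (existT P t p).
  by have [v] := small_image (sP t) (fun p => (cP (existT P t p)).1); exists v.
have [u uU uP] := small_bigcup sT (fun t => (vP t).1).
have cu s : c s ∈ u.
  by apply/uP; exists (projT1 s); apply/(vP _).2; exists (projT2 s); case: s.
exists u => //; exists (fun s => exist (zmem^~ u) _ (cu s)).
move=> -[t p] [k q] [ckq].
have [_ o1] := cP (existT P t p); have [_ o2] := cP (existT P k q).
rewrite -ckq in o2.
(* First components are identified first, since the type of the second ones depends on them. *)
have [/sval_inj/f_inj /= tk] := is_opair_inj o1 o2.
by subst k => /sval_inj/g_inj ->.
Qed.

Lemma small_hom (C : category) (X Y : elt (ob C)) :
  hom_mem U X Y -> small_type U (hom X Y).
Proof.
move=> [h [hP hU]].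
have fh (f : hom X Y) : sval (sval f) ∈ h by apply/hP; exists f.
exists h => //; exists (fun f => exist (zmem^~ h) _ (fh f)) => f g [fg].
by do 2!apply: sval_inj.
Qed.

End Smallness.

(** * Categories of elements *)

Section CategoryOfType.
Variables (U : zset) (univU : pre_universe U).
Variables (O : Type) (M : O -> O -> Type).
Variables (id1 : forall x, M x x).
Variables (mul : forall x y z, M y z -> M x y -> M x z).
Hypothesis mul1m : forall x y (f : M x y), mul (id1 y) f = f.
Hypothesis mulm1 : forall x y (f : M x y), mul f (id1 x) = f.
Hypothesis mulA : forall w x y z (h : M y z) (g : M x y) (f : M w x),
  mul h (mul g f) = mul (mul h g) f.
Hypothesis smallO : small_type U O.
Hypothesis smallM : forall x y, small_type U (M x y).

(** A morphism of a [category] determines its source and target, so the morphism set has to code the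
    total type of triples (source, target, arrow). The hom-types are its fibres, and the laws are
    transported along the coding. *)
Lemma small_category_of_type :
  exists (J : category) (d : elt (ob J) -> O)
      (dm : forall x y, hom x y -> M (d x) (d y)),
    [/\ small U J, bijective d, forall x y, bijective (@dm x y),
        forall x, dm _ _ (idm x) = id1 (d x) &
        forall x y z (g : hom y z) (f : hom x y),
          dm _ _ (g ⊚ f) = mul (dm _ _ g) (dm _ _ f)].
Proof.
have [o oU [e [d eK dK]]] := small_bijective univU smallO.
have smallT : small_type U {x & {y & M x y}}.
  by apply: small_sigma => // x; apply: small_sigma.
have [m mU [em [dem emK demK]]] := small_bijective univU smallT.
pose Q := @Quiver o m (fun f => e (projT1 (dem f)))
  (fun f => e (projT1 (projT2 (dem f)))).
pose arrow x y (f : M (d x) (d y)) : {x & {y & M x y}} :=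
  existT _ (d x) (existT _ (d y) f).
have arrowP x y (f : M (d x) (d y)) :
    @src Q (em (arrow x y f)) = x /\ @tgt Q (em (arrow x y f)) = y.
  by rewrite /= emK /= !dK.
pose up x y f : @hom Q x y := exist _ _ (arrowP x y f).
(* Surjectivity replaces [x] and [y] by the endpoints read off from [f]; injectivity peels the two
   nested pairs off a code. *)
have up_bij x y : bijective (up x y).
  apply/bijective_exists_unique => -[f fP].
  have [g gf] : exists g, em (arrow x y g) = f.
    case: fP => /= <- <-; rewrite /arrow !eK.
    exists (projT2 (projT2 (dem f))).
    by rewrite -[RHS]demK; case: (dem f) => a [b g].
  exists g; split=> [|k [kf]]; first exact: eq_exist.
  apply: (existT_inj (P := M (d x))).
  apply: (existT_inj (P := fun a => {b & M a b})).
  by apply: (can_inj emK); rewrite [LHS]gf.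
have /dep_choice [dn dnP] x : exists dn : forall y, @hom Q x y -> M (d x) (d y),
    forall y, cancel (up x y) (dn y) /\ cancel (dn y) (up x y).
  apply: (dep_choice (P := fun y g => cancel _ g /\ cancel g _)) => y.
  by have [g] := up_bij x y; exists g.
have upK x y := (dnP x y).1; have dnK x y := (dnP x y).2.
(* [J] still awaits its three laws, which are proved next. *)
pose J := @Category Q (fun x => up _ _ (id1 (d x)))
  (fun x y z g f => up _ _ (mul (dn _ _ g) (dn _ _ f))).
have J1m x y (f : @hom Q x y) :
    up _ _ (mul (dn _ _ (up _ _ (id1 (d y)))) (dn _ _ f)) = f.
  by rewrite upK mul1m dnK.
have Jm1 x y (f : @hom Q x y) :
    up _ _ (mul (dn _ _ f) (dn _ _ (up _ _ (id1 (d x))))) = f.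
  by rewrite upK mulm1 dnK.
have JA w x y z (h : @hom Q y z) (g : @hom Q x y) (f : @hom Q w x) :
    up _ _ (mul (dn _ _ h) (dn _ _ (up _ _ (mul (dn _ _ g) (dn _ _ f))))) =
    up _ _ (mul (dn _ _ (up _ _ (mul (dn _ _ h) (dn _ _ g)))) (dn _ _ f)).
  by rewrite !upK mulA.
exists (J J1m Jm1 JA), d, dn; split=> //=; first by exists e.
- by move=> x y; exists (up x y).
- by move=> x; rewrite upK.
- by move=> x y z g f; rewrite upK.
Qed.

End CategoryOfType.

(* The relation [R f p q] plays the part of "f carries p to q", so that both
   the covariant family Hom(X, F -) and the contravariant one Hom(F -, X) are
   covered. *)
Record category_of_elements (A : category) (P : elt (ob A) -> Type)
    (R : forall a b, hom a b -> P a -> P b -> Prop)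
    (J : category) (T : functor J A) (pt : forall x, P (T x)) : Prop := {
  elements_map : forall x y (f : hom x y),
    R (T x) (T y) (fmap T f) (pt x) (pt y);
  elements_lift : forall x y (f : hom (T x) (T y)), R _ _ f (pt x) (pt y) ->
    exists g, fmap T g = f;
  elements_section : forall (Q : forall a, P a -> Type)
    (q : forall x, Q (T x) (pt x)),
    exists n : forall a p, Q a p, forall x, n (T x) (pt x) = q x }.

(** This is [elements_section] for a [Prop]-valued [Q]. *)
Lemma elements_ind (A : category) (P : elt (ob A) -> Type)
    (R : forall a b, hom a b -> P a -> P b -> Prop) (J : category)
    (T : functor J A) (pt : forall x, P (T x)) (B : forall a, P a -> Prop) :
  category_of_elements R pt -> (forall x, B (T x) (pt x)) -> forall a p, B a p.
Proof. by move=> elJ Bpt; have [b _] := elements_section elJ Bpt. Qed.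

(** Pairs [(a, p)] as objects and arrows [f] respecting [R] form small types, which are then coded
    by sets in [U]. *)
Lemma small_category_of_elements (U : zset) (A : category)
    (P : elt (ob A) -> Type) (R : forall a b, hom a b -> P a -> P b -> Prop) :
  pre_universe U -> small U A -> (forall a, small_type U (P a)) ->
  (forall a p, R a a (idm a) p p) ->
  (forall a b c (g : hom b c) (f : hom a b) p q r,
    R _ _ f p q -> R _ _ g q r -> R _ _ (g ⊚ f) p r) ->
  exists J T pt, small U J /\ @category_of_elements A P R J T pt.
Proof.
move=> univU [obU morU] smallP R1 RM.
pose M (x y : {a & P a}) :=
  {f : hom (projT1 x) (projT1 y) | R _ _ f (projT2 x) (projT2 y)}.
pose id1 (x : {a & P a}) : M x x := exist _ (idm _) (R1 _ (projT2 x)).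
pose mul (x y z : {a & P a}) (g : M y z) (f : M x y) : M x z :=
  exist _ (sval g ⊚ sval f) (RM _ _ _ _ _ _ _ _ (proj2_sig f) (proj2_sig g)).
have [|||||J [d [dm [smallJ [e dK eK] dm_bij dm1 dmM]]]] :=
    @small_category_of_type U univU {a & P a} M id1 mul.
- by move=> x y f; apply/sval_inj/comp1m.
- by move=> x y f; apply/sval_inj/compm1.
- by move=> w x y z h g f; apply/sval_inj/compA.
- by apply: small_sigma => //; apply: small_elt.
- move=> x y; apply: (small_inj (f := fun f : M x y => sval (sval f))).
    by move=> f g fg; do 2!apply: sval_inj.
  exact: small_elt.
have T1 x : sval (dm _ _ (idm x)) = idm (projT1 (d x)) by rewrite dm1.
have TM x y z (g : hom y z) (f : hom x y) :
  sval (dm _ _ (g ⊚ f)) = sval (dm _ _ g) ⊚ sval (dm _ _ f) by rewrite dmM.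
exists J, (Functor T1 TM), (fun x => projT2 (d x)); split=> //; split=> /=.
- by move=> x y f; apply: proj2_sig (dm _ _ f).
- move=> x y f fR; have [g gK dmK] := dm_bij x y.
  by exists (g (exist _ f fR)); rewrite dmK.
- move=> Q q.
  (* The value at [s] is [q] at the unique [x] with [d x = s]. Stated with a cast for every such
     [x], it specialises to [d x] by [erefl]. *)
  have /dep_choice [n nP] (s : {a & P a}) : exists v : Q (projT1 s) (projT2 s),
      forall x (xs : d x = s), ecast s (Q (projT1 s) (projT2 s)) xs (q x) = v.
    rewrite -(eK s); exists (q (e s)) => x /[dup] /(can_inj dK) -> xs.
    by rewrite (Prop_irrelevance xs erefl).
  exists (fun a p => n (existT _ a p)) => x; rewrite (nP _ x erefl).
  by case: (d x).
Qed.

(** * Right Kan extensions *)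

Section RightKanExtension.

(** Members of [nat_from] with equal components are equal, by functional extensionality and proof
    irrelevance, so bijectivity turns into unique solvability. *)
Lemma is_ran_alongP (A C D : category) (F : functor A C) (G : functor A D)
    (H : functor C D) (eps : nattrans (H ∘ F) G) :
  is_ran_along F G H eps <->
  forall X Y (n : forall a, hom X (F a) -> hom Y (G a)),
    (forall a b (f : hom a b) (u : hom X (F a)),
      n b (fmap F f ⊚ u) = fmap G f ⊚ n a u) ->
    exists! h : hom Y (H X), forall a (u : hom X (F a)),
      eps a ⊚ fmap H u ⊚ h = n a u.
Proof.
have ran_mapP X Y (n : nat_from F G X Y) h :
    ran_map eps h = n <-> forall a u, eps a ⊚ fmap H u ⊚ h = sval n a u.
  split=> [<- // |]; case: n => n nE hn; apply: eq_exist.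
  by apply: functional_extensionality_dep => a; apply/funext => u; apply: hn.
split=> [ran X Y n nE | ran X Y].
  have /bijective_exists_unique/(_ (exist _ n nE)) [h [/ran_mapP hn hU]] :=
    ran X Y.
  by exists h; split=> // k kn; apply/hU/ran_mapP.
apply/bijective_exists_unique => n.
have [h [hn hU]] := ran X Y (sval n) (proj2_sig n).
by exists h; split=> [|k /ran_mapP/hU //]; apply/ran_mapP.
Qed.

(** Both maps solve the problem posed by the family that [h] induces. This is the test for equality
    of maps into a Kan extension. *)
Lemma ran_hom_inj (A C D : category) (F : functor A C) (G : functor A D)
    (H : functor C D) (eps : nattrans (H ∘ F) G) X Y (h k : hom Y (H X)) :
  is_ran_along F G H eps ->
  (forall a (u : hom X (F a)),
    eps a ⊚ fmap H u ⊚ h = eps a ⊚ fmap H u ⊚ k) ->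
  h = k.
Proof.
move=> /is_ran_alongP-/(_ X Y) ran hk.
have [l [_ lU]] := ran _ (ran_map_natural eps h).
by rewrite -(lU h) // -(lU k) // => a u; rewrite hk.
Qed.

(** The counit for [K] is [eps] after the inverse [be], and [al X] carries solutions from [H X] to
    [K X]. *)
Lemma ran_natiso (A C D : category) (F : functor A C) (G : functor A D)
    (H K : functor C D) :
  functor_iso H K -> is_pointwise_ran F G H -> is_pointwise_ran F G K.
Proof.
move=> [al /is_natiso_inv [be beP]] [eps ran].
have eE a b (f : hom a b) :
    eps b ⊚ be (F b) ⊚ fmap (K ∘ F) f = fmap G f ⊚ (eps a ⊚ be (F a)).
  by rewrite -compA (ncompE be) !compA -(ncompE eps).
exists (NatTrans eE); apply/is_ran_alongP => X Y n nE.
have [h [hn hU]] := (is_ran_alongP _).1 ran X Y n nE.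
exists (al X ⊚ h); split=> [a u | k kn] /=.
  rewrite -hn -[_ ⊚ be _ ⊚ _]compA (ncompE be) -!compA; do 2!congr (_ ⊚ _).
  by rewrite compA (beP X).1 comp1m.
rewrite (hU (be X ⊚ k)) ?compA ?(beP X).2 ?comp1m // => a u.
by rewrite -kn /= -[_ ⊚ be _ ⊚ _]compA (ncompE be) !compA.
Qed.

(** As [i] is fully faithful, a family on [Hom(X, F -)] is one on [Hom(i X, i F -)], so the
    universal property at [i X] is the one wanted at [X]. *)
Lemma ran_precomp (A C C' D : category) (F : functor A C) (G : functor A D)
    (i : functor C C') (K : functor C' D) :
  fully_faithful i -> is_pointwise_ran (i ∘ F) G K ->
  is_pointwise_ran F G (K ∘ i).
Proof.
move=> iff [eps ran]; exists (@NatTrans _ _ (K ∘ i ∘ F) G eps (ncompE eps)).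
apply/is_ran_alongP => X Y n nE.
have [i' i'P] := fully_faithful_inv iff.
have [|h [hn hU]] :=
    (is_ran_alongP _).1 ran (i X) Y (fun a u => n a (i' X (F a) u)).
  move=> a b f u.
  by rewrite -nE -{1}((i'P _ _).2 u) /= -fmapM (i'P _ _).1.
exists h; split=> [a u | k kn] /=; first by rewrite hn (i'P _ _).1.
by apply: hU => a u; rewrite -kn /= (i'P _ _).2.
Qed.

(** The counit and the solutions are pulled back through [fmap j], whose injectivity yields the
    equations. *)
Lemma ran_reflect (A C D E : category) (F : functor A C) (G : functor A D)
    (H : functor C D) (j : functor D E) :
  fully_faithful j -> is_pointwise_ran F (j ∘ G) (j ∘ H) ->
  is_pointwise_ran F G H.
Proof.
move=> /fully_faithful_inv [j' j'P] [eps ran].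
have eE a b (f : hom a b) :
    j' _ _ (eps b) ⊚ fmap (H ∘ F) f = fmap G f ⊚ j' _ _ (eps a).
  apply: (can_inj (j'P _ _).1); rewrite !fmapM !(j'P _ _).2.
  exact: (ncompE eps).
exists (NatTrans eE); apply/is_ran_alongP => X Y n nE.
have [|h [hn hU]] :=
    (is_ran_alongP _).1 ran X (j Y) (fun a u => fmap j (n a u)).
  by move=> a b f u; rewrite nE fmapM.
exists (j' _ _ h); split=> [a u | k kn] /=.
  by apply: (can_inj (j'P _ _).1); rewrite !fmapM !(j'P _ _).2 -hn.
rewrite (hU (fmap j k)) ?(j'P _ _).1 // => a u.
by rewrite -kn /= !fmapM (j'P _ _).2.
Qed.

(** Yoneda: the universal property at [i X], applied to the family sending [u] to [fmap L (i' u)],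
    yields the inverse [h] of [eps X]; evaluation at the identity gives one composite. *)
Lemma ran_counit_natiso (C C' D : category) (i : functor C C')
    (L : functor C D) (K : functor C' D) (eps : nattrans (K ∘ i) L) :
  fully_faithful i -> is_ran_along i L K eps -> is_natiso eps.
Proof.
move=> /fully_faithful_inv [i' i'P] ran X.
have [|h [hn _]] := (is_ran_alongP _).1 ran (i X) (L X)
    (fun c u => fmap L (i' _ _ u)).
  move=> c d f u; rewrite -fmapM; congr fmap.
  by apply: (can_inj (i'P _ _).1); rewrite fmapM !(i'P _ _).2.
have epsK : eps X ⊚ h = idm (L X).
  have := hn X (idm (i X)).
  by rewrite fmap1 compm1 -(fmap1 i) (i'P _ _).1 fmap1.
(* For the other composite, each [u] is written as the image under [i] of [i' u], where [eps] is
   natural. *)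
exists h; split=> //; apply: ran_hom_inj ran _ => c u.
rewrite compA hn compm1 -{2}((i'P _ _).2 u).
exact/esym/(ncompE eps).
Qed.

(** * Right extensions along [i] compared with those along [i ∘ F] *)

Section Composition.
Variables (A C E : category) (F : functor A C) (T : functor A E).
Variables (L : functor C E) (e : nattrans (L ∘ F) T).
Hypothesis ranL : is_ran_along F T L e.
Variables (C' : category) (i : functor C C') (K : functor C' E).

(** One direction composes with [e]. For the other, maps into [L c] are tested against all
    [e a ⊚ fmap L v], and naturality of [m] and [eps] brings [v] inside. *)
Lemma ran_compE (eps : nattrans (K ∘ i) L) (eps' : nattrans (K ∘ (i ∘ F)) T)
    X Y (m : forall c, hom X (i c) -> hom Y (L c))
    (n : forall a, hom X (i (F a)) -> hom Y (T a)) (h : hom Y (K X)) :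
  (forall a, eps' a = e a ⊚ eps (F a)) ->
  (forall c d (f : hom c d) (u : hom X (i c)),
    m d (fmap i f ⊚ u) = fmap L f ⊚ m c u) ->
  (forall a u, e a ⊚ m (F a) u = n a u) ->
  (forall c (u : hom X (i c)), eps c ⊚ fmap K u ⊚ h = m c u) <->
  (forall a (u : hom X (i (F a))), eps' a ⊚ fmap K u ⊚ h = n a u).
Proof.
move=> eps'E mE emn; split=> [hm a u | hn c u].
  by rewrite eps'E -emn -hm !compA.
apply: ran_hom_inj ranL _ => a v.
rewrite -[RHS]compA -mE emn -hn eps'E fmapM !compA; congr (_ ⊚ _ ⊚ _).
by rewrite -!compA -(ncompE eps).
Qed.

(** Natural families into [L] and into [T] correspond through [e], and by [ran_compE] corresponding
    families have the same solutions. *)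
Lemma ran_comp (eps : nattrans (K ∘ i) L) (eps' : nattrans (K ∘ (i ∘ F)) T) :
  (forall a, eps' a = e a ⊚ eps (F a)) ->
  is_ran_along i L K eps <-> is_ran_along (i ∘ F) T K eps'.
Proof.
move=> eps'E; split=> /is_ran_alongP ran; apply/is_ran_alongP => X Y.
  move=> n nE.
  (* [m c u] represents the family [v ↦ n a (fmap i v ⊚ u)]; taking [v] to be an identity recovers
     [n]. *)
  have m_ex c : exists mc : hom X (i c) -> hom Y (L c), forall u a v,
      e a ⊚ fmap L v ⊚ mc u = n a (fmap i v ⊚ u).
    apply: (dep_choice (P := fun u h => forall a v,
      e a ⊚ fmap L v ⊚ h = n a (fmap i v ⊚ u))) => u.
    have [|h [hn _]] := (is_ran_alongP _).1 ranL c Y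
      (fun a v => n a (fmap i v ⊚ u)); last by exists h.
    by move=> a b f v; rewrite -nE fmapM compA.
  have [m mP] := dep_choice m_ex.
  have mE c d (f : hom c d) u : m d (fmap i f ⊚ u) = fmap L f ⊚ m c u.
    apply: ran_hom_inj ranL _ => a v.
    by rewrite mP compA -fmapM -[RHS]compA compA -mP fmapM !compA.
  have emn a u : e a ⊚ m (F a) u = n a u.
    by have := mP _ u a (idm (F a)); rewrite !fmap1 compm1 comp1m.
  have [h [hm hU]] := ran X Y m mE; exists h.
  by split=> [|k kn]; [|apply: hU]; apply/(ran_compE _ eps'E mE emn).
move=> m mE; pose n a u := e a ⊚ m (F a) u.
have emn a u : e a ⊚ m (F a) u = n a u by [].
have [|h [hn hU]] := ran X Y n.
  by move=> a b f u; rewrite /n mE !compA (ncompE e).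
exists h.
by split=> [|k kn]; [|apply: hU]; apply/(ran_compE _ eps'E mE emn).
Qed.

Lemma ran_comp_counit (eps : nattrans (K ∘ i) L) :
  exists eps' : nattrans (K ∘ (i ∘ F)) T, forall a, eps' a = e a ⊚ eps (F a).
Proof.
have eE a b (f : hom a b) :
    e b ⊚ eps (F b) ⊚ fmap (K ∘ (i ∘ F)) f = fmap T f ⊚ (e a ⊚ eps (F a)).
  by rewrite -compA (ncompE eps) !compA (ncompE e).
by exists (NatTrans eE).
Qed.

(** [eps c] comes from the universal property of [L c] applied to [u ↦ eps' a ⊚ fmap K (fmap i u)];
    the factorisation is the case of the identity of [F a]. *)
Lemma ran_decomp_counit (eps' : nattrans (K ∘ (i ∘ F)) T) :
  exists eps : nattrans (K ∘ i) L, forall a, eps' a = e a ⊚ eps (F a).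
Proof.
have [eps epsP] : exists eps : forall c, hom (K (i c)) (L c),
    forall c a u, e a ⊚ fmap L u ⊚ eps c = eps' a ⊚ fmap K (fmap i u).
  apply: (dep_choice (P := fun c h => forall a u,
    e a ⊚ fmap L u ⊚ h = eps' a ⊚ fmap K (fmap i u))) => c.
  have [|h [hn _]] := (is_ran_alongP _).1 ranL c (K (i c))
    (fun a u => eps' a ⊚ fmap K (fmap i u)); last by exists h.
  by move=> a b f u; rewrite compA -(ncompE eps') !fmapM !compA.
have epsE c d (f : hom c d) :
    eps d ⊚ fmap (K ∘ i) f = fmap L f ⊚ eps c.
  apply: ran_hom_inj ranL _ => a u.
  by rewrite !compA epsP -[e a ⊚ _ ⊚ _]compA -fmapM epsP !fmapM !compA.
exists (NatTrans epsE) => a /=.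
by have := epsP _ a (idm (F a)); rewrite !fmap1 !compm1.
Qed.

Lemma pointwise_ran_comp :
  is_pointwise_ran i L K <-> is_pointwise_ran (i ∘ F) T K.
Proof.
split=> [] [eps ran].
  by have [eps' /ran_comp ranE] := ran_comp_counit eps; exists eps'; apply/ranE.
by have [eps' /ran_comp ranE] := ran_decomp_counit eps; exists eps'; apply/ranE.
Qed.

End Composition.

(** * Values of right Kan extensions as limits over categories of elements *)

Section RanLimits.
Variables (A C : category) (F : functor A C) (X : elt (ob C)).
Variables (J : category) (T : functor J A) (pt : forall x, hom X (F (T x))).
Hypothesis elJ : @category_of_elements A (fun a => hom X (F a))
  (fun a b f u v => fmap F f ⊚ u = v) J T pt.

(* The left-hand side is [is_ran_along F G H eps] restricted to this [X]. *)
Lemma ran_at_limitP (D : category) (G : functor A D) (H : functor C D)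
    (eps : nattrans (H ∘ F) G) (p : forall x, hom (H X) (G (T x))) :
  (forall x, p x = eps (T x) ⊚ fmap H (pt x)) ->
  (forall Y (n : forall a, hom X (F a) -> hom Y (G a)),
    (forall a b (f : hom a b) (u : hom X (F a)),
      n b (fmap F f ⊚ u) = fmap G f ⊚ n a u) ->
    exists! h : hom Y (H X), forall a (u : hom X (F a)),
      eps a ⊚ fmap H u ⊚ h = n a u) <->
  @is_limit J D (G ∘ T) (H X) p.
Proof.
move=> pE.
have transposeE Y (n : forall a, hom X (F a) -> hom Y (G a))
    (q : forall x, hom Y (G (T x))) h : (forall x, n (T x) (pt x) = q x) ->
    (forall a u, eps a ⊚ fmap H u ⊚ h = n a u) <-> (forall x, p x ⊚ h = q x).
  move=> nq; split=> [hn x | hq]; first by rewrite pE hn.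
  apply: (elements_ind (B := fun a u => eps a ⊚ fmap H u ⊚ h = n a u) elJ) => x.
  by rewrite -pE hq nq.
split=> [ran | [_ lim]].
  split=> [x y f | Y q qE] /=.
    by rewrite !pE compA -(ncompE eps) /= -compA -fmapM (elements_map elJ).
  (* The legs of the cone [q] are spread over all [u : hom Y' (F a)] with [Y' = X], giving the
     candidate family [n]. *)
  have [n nq] := elements_section elJ (Q := fun a _ => hom Y (G a)) q.
  have [|h [hn hU]] := ran Y n; last first.
    exists h; split=> [|k kq]; first exact/(transposeE _ n).
    exact/hU/(transposeE _ n q).
  (* With a free [v] for [fmap F f ⊚ u], both ends can be taken of the form [pt x]; then [f] lifts
     to [J] and the cone condition applies. *)
  suff nE a u b v : forall f : hom a b,
      fmap F f ⊚ u = v -> n b v = fmap G f ⊚ n a u by move=> a b f u; apply: nE.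
  move: b v; apply: (elements_ind (B := fun b v => forall f : hom a b,
    fmap F f ⊚ u = v -> n b v = fmap G f ⊚ n a u) elJ) => y; move: a u.
  apply: (elements_ind (B := fun a u => forall f : hom a (T y),
    fmap F f ⊚ u = pt y -> n _ (pt y) = fmap G f ⊚ n a u) elJ) => x f.
  by move=> /(elements_lift elJ) [g <-]; rewrite !nq -(qE _ _ g).
move=> Y n nE; have [|h [hq hU]] := lim Y (fun x => n (T x) (pt x)).
  by move=> x y f; rewrite -nE (elements_map elJ).
exists h; split=> [|k kn]; first exact/(transposeE _ n _ h _).2.
exact/hU/(transposeE _ n _ k _).1.
Qed.

End RanLimits.

(** At each [X] the category of elements is [U]-small, so [j] preserves the limit computing [H X];
    [ran_at_limitP] is used for [eps] and again for its image [jeps]. *)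
Lemma preserves_limits_ran (U : zset) (A C D E : category) (F : functor A C)
    (G : functor A D) (H : functor C D) (j : functor D E) :
  pre_universe U -> small U A -> (forall X a, hom_mem U X (F a)) ->
  preserves_limits U j -> is_pointwise_ran F G H ->
  is_pointwise_ran F (j ∘ G) (j ∘ H).
Proof.
move=> univU smallA smallF jlim [eps ran].
have jE a b (f : hom a b) : fmap j (eps b) ⊚ fmap (j ∘ H ∘ F) f =
    fmap (j ∘ G) f ⊚ fmap j (eps a) by rewrite /= -!fmapM (ncompE eps).
pose jeps := @NatTrans _ _ (j ∘ H ∘ F) (j ∘ G) (fun a => fmap j (eps a)) jE.
exists jeps; apply/is_ran_alongP => X.
have [|||J [T [pt [smallJ elJ]]]] := @small_category_of_elements U A
  (fun a => hom X (F a)) (fun a b f u v => fmap F f ⊚ u = v) univU smallA.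
- by move=> a; apply: small_hom.
- by move=> a u; rewrite fmap1 comp1m.
- by move=> a b c g f u v w <- <-; rewrite fmapM compA.
apply/(ran_at_limitP elJ (eps := jeps)
  (p := fun x => fmap j (eps (T x) ⊚ fmap H (pt x)))).
  by move=> x; rewrite fmapM.
apply: (jlim _ (G ∘ T)) => //.
apply/(ran_at_limitP elJ (eps := eps)) => // Y n nE.
by apply: (is_ran_alongP _).1.
Qed.

End RightKanExtension.

(** * Left Kan extensions *)

Section LeftKanExtension.

Lemma is_lan_alongP (A C D : category) (F : functor A C) (G : functor A D)
    (H : functor C D) (eta : nattrans G (H ∘ F)) :
  is_lan_along F G H eta <->
  forall X Y (n : forall a, hom (F a) X -> hom (G a) Y),
    (forall a b (f : hom a b) (u : hom (F b) X),
      n a (u ⊚ fmap F f) = n b u ⊚ fmap G f) ->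
    exists! h : hom (H X) Y, forall a (u : hom (F a) X),
      h ⊚ fmap H u ⊚ eta a = n a u.
Proof.
have lan_mapP X Y (n : nat_to F G X Y) h :
    lan_map eta h = n <-> forall a u, h ⊚ fmap H u ⊚ eta a = sval n a u.
  split=> [<- // |]; case: n => n nE hn; apply: eq_exist.
  by apply: functional_extensionality_dep => a; apply/funext => u; apply: hn.
split=> [lan X Y n nE | lan X Y].
  have /bijective_exists_unique/(_ (exist _ n nE)) [h [/lan_mapP hn hU]] :=
    lan X Y.
  by exists h; split=> // k kn; apply/hU/lan_mapP.
apply/bijective_exists_unique => n.
have [h [hn hU]] := lan X Y (sval n) (proj2_sig n).
by exists h; split=> [|k /lan_mapP/hU //]; apply/lan_mapP.
Qed.

(** The test for equality of maps out of a Kan extension, again from uniqueness of the solution. *)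
Lemma lan_hom_inj (A C D : category) (F : functor A C) (G : functor A D)
    (H : functor C D) (eta : nattrans G (H ∘ F)) X Y (h k : hom (H X) Y) :
  is_lan_along F G H eta ->
  (forall a (u : hom (F a) X),
    h ⊚ fmap H u ⊚ eta a = k ⊚ fmap H u ⊚ eta a) ->
  h = k.
Proof.
move=> /is_lan_alongP-/(_ X Y) lan hk.
have [l [_ lU]] := lan _ (lan_map_natural eta h).
by rewrite -(lU h) // -(lU k) // => a u; rewrite hk.
Qed.

(** The unit is followed by [al], and solutions are precomposed with the inverse [be X]. *)
Lemma lan_natiso (A C D : category) (F : functor A C) (G : functor A D)
    (H K : functor C D) :
  functor_iso H K -> is_pointwise_lan F G H -> is_pointwise_lan F G K.
Proof.
move=> [al /is_natiso_inv [be beP]] [eta lan].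
have eE a b (f : hom a b) :
    al (F b) ⊚ eta b ⊚ fmap G f = fmap (K ∘ F) f ⊚ (al (F a) ⊚ eta a).
  by rewrite -compA (ncompE eta) !compA (ncompE al).
exists (@NatTrans _ _ G (K ∘ F) (fun a => al (F a) ⊚ eta a) eE).
apply/is_lan_alongP => X Y n nE.
have [h [hn hU]] := (is_lan_alongP _).1 lan X Y n nE.
exists (h ⊚ be X); split=> [a u | k kn] /=.
  rewrite -hn !compA -[h ⊚ _ ⊚ _]compA (ncompE be).
  by rewrite -[h ⊚ _ ⊚ al _]compA -[_ ⊚ al _]compA (beP _).1 compm1.
rewrite (hU (k ⊚ al X)) -?compA ?(beP X).2 ?compm1 // => a u.
by rewrite -kn /= -[k ⊚ _ ⊚ _]compA (ncompE al) !compA.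
Qed.

Lemma lan_precomp (A C C' D : category) (F : functor A C) (G : functor A D)
    (i : functor C C') (K : functor C' D) :
  fully_faithful i -> is_pointwise_lan (i ∘ F) G K ->
  is_pointwise_lan F G (K ∘ i).
Proof.
move=> iff [eta lan]; exists (@NatTrans _ _ G (K ∘ i ∘ F) eta (ncompE eta)).
apply/is_lan_alongP => X Y n nE.
have [i' i'P] := fully_faithful_inv iff.
have [|h [hn hU]] :=
    (is_lan_alongP _).1 lan (i X) Y (fun a u => n a (i' (F a) X u)).
  move=> a b f u.
  by rewrite -nE -{1}((i'P _ _).2 u) /= -fmapM (i'P _ _).1.
exists h; split=> [a u | k kn] /=; first by rewrite hn (i'P _ _).1.
by apply: hU => a u; rewrite -kn /= (i'P _ _).2.
Qed.

Lemma lan_reflect (A C D E : category) (F : functor A C) (G : functor A D)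
    (H : functor C D) (j : functor D E) :
  fully_faithful j -> is_pointwise_lan F (j ∘ G) (j ∘ H) ->
  is_pointwise_lan F G H.
Proof.
move=> /fully_faithful_inv [j' j'P] [eta lan].
have eE a b (f : hom a b) :
    j' _ _ (eta b) ⊚ fmap G f = fmap (H ∘ F) f ⊚ j' _ _ (eta a).
  apply: (can_inj (j'P _ _).1); rewrite !fmapM !(j'P _ _).2.
  exact: (ncompE eta).
exists (@NatTrans _ _ G (H ∘ F) (fun a => j' _ _ (eta a)) eE).
apply/is_lan_alongP => X Y n nE.
have [|h [hn hU]] :=
    (is_lan_alongP _).1 lan X (j Y) (fun a u => fmap j (n a u)).
  by move=> a b f u; rewrite nE fmapM.
exists (j' _ _ h); split=> [a u | k kn] /=.
  by apply: (can_inj (j'P _ _).1); rewrite !fmapM !(j'P _ _).2 -hn.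
rewrite (hU (fmap j k)) ?(j'P _ _).1 // => a u.
by rewrite -kn /= !fmapM (j'P _ _).2.
Qed.

(** Yoneda for the contravariant family [u ↦ fmap L (i' u)] on [Hom(i -, i X)]; the solution [h]
    inverts [eta X]. *)
Lemma lan_unit_natiso (C C' D : category) (i : functor C C')
    (L : functor C D) (K : functor C' D) (eta : nattrans L (K ∘ i)) :
  fully_faithful i -> is_lan_along i L K eta -> is_natiso eta.
Proof.
move=> /fully_faithful_inv [i' i'P] lan X.
have [|h [hn _]] := (is_lan_alongP _).1 lan (i X) (L X)
    (fun c u => fmap L (i' _ _ u)).
  move=> c d f u; rewrite -fmapM; congr fmap.
  by apply: (can_inj (i'P _ _).1); rewrite fmapM !(i'P _ _).2.
have etaK : h ⊚ eta X = idm (L X).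
  have := hn X (idm (i X)).
  by rewrite fmap1 compm1 -(fmap1 i) (i'P _ _).1 fmap1.
exists h; split=> //; apply: lan_hom_inj lan _ => c u.
rewrite -[LHS]compA -[LHS]compA [h ⊚ _]compA hn comp1m -{2}((i'P _ _).2 u).
exact: (ncompE eta).
Qed.

(** * Left extensions along [i] compared with those along [i ∘ F] *)

Section Composition.
Variables (A C E : category) (F : functor A C) (T : functor A E).
Variables (L : functor C E) (e : nattrans T (L ∘ F)).
Hypothesis lanL : is_lan_along F T L e.
Variables (C' : category) (i : functor C C') (K : functor C' E).

(** Maps out of [L c] are tested by precomposition with all [fmap L v ⊚ e a]. *)
Lemma lan_compE (eta : nattrans L (K ∘ i)) (eta' : nattrans T (K ∘ (i ∘ F)))
    X Y (m : forall c, hom (i c) X -> hom (L c) Y)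
    (n : forall a, hom (i (F a)) X -> hom (T a) Y) (h : hom (K X) Y) :
  (forall a, eta' a = eta (F a) ⊚ e a) ->
  (forall c d (f : hom c d) (u : hom (i d) X),
    m c (u ⊚ fmap i f) = m d u ⊚ fmap L f) ->
  (forall a u, m (F a) u ⊚ e a = n a u) ->
  (forall c (u : hom (i c) X), h ⊚ fmap K u ⊚ eta c = m c u) <->
  (forall a (u : hom (i (F a)) X), h ⊚ fmap K u ⊚ eta' a = n a u).
Proof.
move=> eta'E mE emn; split=> [hm a u | hn c u].
  by rewrite eta'E -emn -hm !compA.
apply: lan_hom_inj lanL _ => a v.
rewrite -mE emn -hn eta'E fmapM !compA; congr (_ ⊚ _).
by rewrite -!compA (ncompE eta).
Qed.

Lemma lan_comp (eta : nattrans L (K ∘ i)) (eta' : nattrans T (K ∘ (i ∘ F))) :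
  (forall a, eta' a = eta (F a) ⊚ e a) ->
  is_lan_along i L K eta <-> is_lan_along (i ∘ F) T K eta'.
Proof.
move=> eta'E; split=> /is_lan_alongP lan; apply/is_lan_alongP => X Y.
  move=> n nE.
  (* [m c u] represents the family [v ↦ n a (u ⊚ fmap i v)]. *)
  have m_ex c : exists mc : hom (i c) X -> hom (L c) Y, forall u a v,
      mc u ⊚ fmap L v ⊚ e a = n a (u ⊚ fmap i v).
    apply: (dep_choice (P := fun u h => forall a v,
      h ⊚ fmap L v ⊚ e a = n a (u ⊚ fmap i v))) => u.
    have [|h [hn _]] := (is_lan_alongP _).1 lanL c Y
      (fun a v => n a (u ⊚ fmap i v)); last by exists h.
    by move=> a b f v; rewrite -nE fmapM compA.
  have [m mP] := dep_choice m_ex.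
  have mE c d (f : hom c d) u : m c (u ⊚ fmap i f) = m d u ⊚ fmap L f.
    apply: lan_hom_inj lanL _ => a v.
    by rewrite mP -compA -fmapM -mP fmapM !compA.
  have emn a u : m (F a) u ⊚ e a = n a u.
    by have := mP _ u a (idm (F a)); rewrite !fmap1 !compm1.
  have [h [hm hU]] := lan X Y m mE; exists h.
  by split=> [|k kn]; [|apply: hU]; apply/(lan_compE _ eta'E mE emn).
move=> m mE; pose n a u := m (F a) u ⊚ e a.
have emn a u : m (F a) u ⊚ e a = n a u by [].
have [|h [hn hU]] := lan X Y n.
  by move=> a b f u; rewrite /n mE -!compA (ncompE e).
exists h.
by split=> [|k kn]; [|apply: hU]; apply/(lan_compE _ eta'E mE emn).
Qed.

Lemma lan_comp_unit (eta : nattrans L (K ∘ i)) :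
  exists eta' : nattrans T (K ∘ (i ∘ F)), forall a, eta' a = eta (F a) ⊚ e a.
Proof.
have eE a b (f : hom a b) :
    eta (F b) ⊚ e b ⊚ fmap T f = fmap (K ∘ (i ∘ F)) f ⊚ (eta (F a) ⊚ e a).
  by rewrite -compA (ncompE e) !compA (ncompE eta).
by exists (@NatTrans _ _ T (K ∘ (i ∘ F)) (fun a => eta (F a) ⊚ e a) eE).
Qed.

(** [eta c] is the map out of [L c] determined by the family [u ↦ fmap K (fmap i u) ⊚ eta' a]. *)
Lemma lan_decomp_unit (eta' : nattrans T (K ∘ (i ∘ F))) :
  exists eta : nattrans L (K ∘ i), forall a, eta' a = eta (F a) ⊚ e a.
Proof.
have [eta etaP] : exists eta : forall c, hom (L c) (K (i c)),
    forall c a u, eta c ⊚ fmap L u ⊚ e a = fmap K (fmap i u) ⊚ eta' a.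
  apply: (dep_choice (P := fun c h => forall a u,
    h ⊚ fmap L u ⊚ e a = fmap K (fmap i u) ⊚ eta' a)) => c.
  have [|h [hn _]] := (is_lan_alongP _).1 lanL c (K (i c))
    (fun a u => fmap K (fmap i u) ⊚ eta' a); last by exists h.
  by move=> a b f u; rewrite -compA (ncompE eta') !fmapM !compA.
have etaE c d (f : hom c d) :
    eta d ⊚ fmap L f = fmap (K ∘ i) f ⊚ eta c.
  apply: lan_hom_inj lanL _ => a u.
  rewrite -[eta d ⊚ _ ⊚ _]compA -fmapM etaP !fmapM -!compA; congr (_ ⊚ _).
  by rewrite compA etaP.
exists (@NatTrans _ _ L (K ∘ i) eta etaE) => a /=.
by have := etaP _ a (idm (F a)); rewrite !fmap1 compm1 comp1m.
Qed.

Lemma pointwise_lan_comp :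
  is_pointwise_lan i L K <-> is_pointwise_lan (i ∘ F) T K.
Proof.
split=> [] [eta lan].
  by have [eta' /lan_comp lanE] := lan_comp_unit eta; exists eta'; apply/lanE.
by have [eta' /lan_comp lanE] := lan_decomp_unit eta; exists eta'; apply/lanE.
Qed.

End Composition.

(** * Values of left Kan extensions as colimits over categories of elements *)

Section LanColimits.
Variables (A C : category) (F : functor A C) (X : elt (ob C)).
Variables (J : category) (T : functor J A) (pt : forall x, hom (F (T x)) X).
Hypothesis elJ : @category_of_elements A (fun a => hom (F a) X)
  (fun a b f u v => v ⊚ fmap F f = u) J T pt.

(* The left-hand side is [is_lan_along F G H eta] restricted to this [X]. *)
Lemma lan_at_colimitP (D : category) (G : functor A D) (H : functor C D)
    (eta : nattrans G (H ∘ F)) (p : forall x, hom (G (T x)) (H X)) :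
  (forall x, p x = fmap H (pt x) ⊚ eta (T x)) ->
  (forall Y (n : forall a, hom (F a) X -> hom (G a) Y),
    (forall a b (f : hom a b) (u : hom (F b) X),
      n a (u ⊚ fmap F f) = n b u ⊚ fmap G f) ->
    exists! h : hom (H X) Y, forall a (u : hom (F a) X),
      h ⊚ fmap H u ⊚ eta a = n a u) <->
  @is_colimit J D (G ∘ T) (H X) p.
Proof.
move=> pE.
have transposeE Y (n : forall a, hom (F a) X -> hom (G a) Y)
    (q : forall x, hom (G (T x)) Y) h : (forall x, n (T x) (pt x) = q x) ->
    (forall a u, h ⊚ fmap H u ⊚ eta a = n a u) <-> (forall x, h ⊚ p x = q x).
  move=> nq; split=> [hn x | hq]; first by rewrite pE compA hn.
  apply: (elements_ind (B := fun a u => h ⊚ fmap H u ⊚ eta a = n a u) elJ) => x.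
  by rewrite -compA -pE hq nq.
split=> [lan | [_ colim]].
  split=> [x y f | Y q qE] /=.
    by rewrite !pE -compA (ncompE eta) /= compA -fmapM (elements_map elJ).
  have [n nq] := elements_section elJ (Q := fun a _ => hom (G a) Y) q.
  have [|h [hn hU]] := lan Y n; last first.
    exists h; split=> [|k kq]; first exact/(transposeE _ n).
    exact/hU/(transposeE _ n q).
  (* Here [u] is freed, being the composite [v ⊚ fmap F f], so that both ends can be taken among the
     [pt x]. *)
  suff nE a u b v : forall f : hom a b,
      v ⊚ fmap F f = u -> n a u = n b v ⊚ fmap G f.
    by move=> a b f u; apply: nE.
  move: b v; apply: (elements_ind (B := fun b v => forall f : hom a b,
    v ⊚ fmap F f = u -> n a u = n b v ⊚ fmap G f) elJ) => y; move: a u.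
  apply: (elements_ind (B := fun a u => forall f : hom a (T y),
    pt y ⊚ fmap F f = u -> n a u = n _ (pt y) ⊚ fmap G f) elJ) => x f.
  by move=> /(elements_lift elJ) [g <-]; rewrite !nq -(qE _ _ g).
move=> Y n nE; have [|h [hq hU]] := colim Y (fun x => n (T x) (pt x)).
  by move=> x y f; rewrite -nE (elements_map elJ).
exists h; split=> [|k kn]; first exact/(transposeE _ n _ h _).2.
exact/hU/(transposeE _ n _ k _).1.
Qed.

End LanColimits.

Lemma preserves_colimits_lan (U : zset) (A C D E : category) (F : functor A C)
    (G : functor A D) (H : functor C D) (j : functor D E) :
  pre_universe U -> small U A -> (forall X a, hom_mem U (F a) X) ->
  preserves_colimits U j -> is_pointwise_lan F G H ->
  is_pointwise_lan F (j ∘ G) (j ∘ H).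
Proof.
move=> univU smallA smallF jcolim [eta lan].
have jE a b (f : hom a b) : fmap j (eta b) ⊚ fmap (j ∘ G) f =
    fmap (j ∘ H ∘ F) f ⊚ fmap j (eta a) by rewrite /= -!fmapM (ncompE eta).
pose jeta := @NatTrans _ _ (j ∘ G) (j ∘ H ∘ F) (fun a => fmap j (eta a)) jE.
exists jeta; apply/is_lan_alongP => X.
(* An arrow from [u] to [v] is an [f] with [v ⊚ fmap F f = u]. It points as in [A], so [T] is
   covariant and the cocones are on [G ∘ T]. *)
have [|||J [T [pt [smallJ elJ]]]] := @small_category_of_elements U A
  (fun a => hom (F a) X) (fun a b f u v => v ⊚ fmap F f = u) univU smallA.
- by move=> a; apply: small_hom.
- by move=> a u; rewrite fmap1 compm1.
- by move=> a b c g f u v w <- <-; rewrite fmapM compA.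
apply/(lan_at_colimitP elJ (eta := jeta)
  (p := fun x => fmap j (fmap H (pt x) ⊚ eta (T x)))).
  by move=> x; rewrite fmapM.
apply: (jcolim _ (G ∘ T)) => //.
apply/(lan_at_colimitP elJ (eta := eta)) => // Y n nE.
by apply: (is_lan_alongP _).1.
Qed.

End LeftKanExtension.

Theorem theorem3p14 (Up : zset) (A C D Cp Dp : category)
    (F : functor A C) (G : functor A D)
    (i : functor C Cp) (j : functor D Dp)
    (H : functor C D) (Hp : functor Cp Dp) :
  pre_universe Up -> small Up A ->
  locally_small Up C -> locally_small Up D ->
  locally_small Up Cp -> locally_small Up Dp ->
  fully_faithful i -> fully_faithful j ->
  (* i *)
  (is_pointwise_ran (i ∘ F) (j ∘ G) Hp -> functor_iso (Hp ∘ i) (j ∘ H) ->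
   is_pointwise_ran F G H)
  /\
  (* ii *)
  (small Up C -> is_pointwise_ran F (j ∘ G) (j ∘ H) ->
   (forall eps : nattrans (Hp ∘ i) (j ∘ H),
      is_ran_along i (j ∘ H) Hp eps ->
      is_natiso eps /\ is_pointwise_ran (i ∘ F) (j ∘ G) Hp)
   /\
   (is_pointwise_ran (i ∘ F) (j ∘ G) Hp -> is_pointwise_ran i (j ∘ H) Hp))
  /\
  (* iii *)
  (forall U : zset, pre_universe U -> small U A ->
   (forall X a, hom_mem U X (F a)) ->
   preserves_limits U j -> is_pointwise_ran F G H ->
   forall K : functor Cp Dp,
     is_pointwise_ran (i ∘ F) (j ∘ G) K <-> is_pointwise_ran i (j ∘ H) K)
  /\
  (* i' *)
  (is_pointwise_lan (i ∘ F) (j ∘ G) Hp -> functor_iso (Hp ∘ i) (j ∘ H) ->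
   is_pointwise_lan F G H)
  /\
  (* ii' *)
  (small Up C -> is_pointwise_lan F (j ∘ G) (j ∘ H) ->
   forall eta : nattrans (j ∘ H) (Hp ∘ i),
     is_lan_along i (j ∘ H) Hp eta ->
     is_natiso eta /\ is_pointwise_lan (i ∘ F) (j ∘ G) Hp)
  /\
  (* iii' *)
  (forall U : zset, pre_universe U -> small U A ->
   (forall X a, hom_mem U (F a) X) ->
   preserves_colimits U j -> is_pointwise_lan F G H ->
   forall K : functor Cp Dp,
     is_pointwise_lan (i ∘ F) (j ∘ G) K <-> is_pointwise_lan i (j ∘ H) K).
Proof.
move=> _ _ _ _ _ _ iff jff; split; [|split; [|split; [|split; [|split]]]].
(* Read backwards: restrict along [i], replace [Hp ∘ i] by [j ∘ H], cancel [j]. *)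
- move=> ran iso; apply: (ran_reflect jff); apply: (ran_natiso iso).
  exact: ran_precomp.
- move=> _ [e ranH]; split=> [eps ran | ran]; last first.
    exact/(pointwise_ran_comp ranH).
  split; first exact: ran_counit_natiso ran.
  by apply/(pointwise_ran_comp ranH); exists eps.
- move=> U univU smallA smallF jlim ran K; apply: iff_sym.
  have [e ranH] := preserves_limits_ran univU smallA smallF jlim ran.
  exact: (pointwise_ran_comp ranH).
- move=> lan iso; apply: (lan_reflect jff); apply: (lan_natiso iso).
  exact: lan_precomp.
- move=> _ [e lanH] eta lan.
  split; first exact: lan_unit_natiso lan.
  by apply/(pointwise_lan_comp lanH); exists eta.
- move=> U univU smallA smallF jcolim lan K; apply: iff_sym.
  have [e lanH] := preserves_colimits_lan univU smallA smallF jcolim lan.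
  exact: (pointwise_lan_comp lanH).
Qed.
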